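(* Let $(X,p)$ be a complete partial metric space with $X$ nonempty. Let $\phi:[0,\infty)\to[0,\infty)$ be an increasing function such that the function $f(t)=t-\phi(t)$, $t\in[0,\infty)$, is increasing with inverse function $f^{-1}$ right continuous at $0$, and such that $\lim_{n\to\infty}\phi^n(t)=0$ for all $t\ge 0$ (and hence $\phi(0)=0$ and $\phi(t)<t$ for $t>0$). Suppose $T:X\to X$ is a mapping satisfying, for all $x,y\in X$, $$p(Tx,Ty)\le \max\{\phi(p(x,y)),\,p(x,x),\,p(y,y)\}.$$ Let $\rho_p=\inf\{p(x,y):x,y\in X\}$ and $X_p=\{x\in X: p(x,x)=\rho_p\}$. Then: (1) the set $X_p$ is nonempty; (2) there is a unique $u\in X_p$ such that $Tu=u$; (3) for each $x\in X_p$ the sequence $\{T^nx\}_{n\ge 1}$ converges to $u$ with respect to the metric $p^s$.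
   Context: A partial metric space is a pair $(X,p)$ with $p:X\times X\to[0,\infty)$ such that for all $x,y,z\in X$: (P1) $p(x,y)=p(y,x)$; (P2) if $p(x,x)=p(x,y)=p(y,y)$ then $x=y$; (P3) $p(x,x)\le p(x,y)$; (P4) $p(x,z)+p(y,y)\le p(x,y)+p(y,z)$. The function $p^s(x,y)=2p(x,y)-p(x,x)-p(y,y)$ is a (usual) metric on $X$. The topology $\tau_p$ on $X$ has as a base the open $p$-balls $B_p(x,\varepsilon)=\{y\in X: p(x,y)<p(x,x)+\varepsilon\}$, $x\in X$, $\varepsilon>0$. A sequence $\{x_n\}$ converges to $x$ in $(X,p)$ (with respect to $\tau_p$) iff $p(x,x)=\lim_{n\to\infty}p(x,x_n)$. A sequence $\{x_n\}$ is Cauchy in $(X,p)$ if $\lim_{n,m\to\infty}p(x_n,x_m)$ exists and is finite. $(X,p)$ is complete if every Cauchy sequence $\{x_n\}$ converges with respect to $\tau_p$ to a point $x\in X$ with $p(x,x)=\lim_{n,m\to\infty}p(x_n,x_m)$. $\phi^n$ and $T^n$ denote $n$-fold iterates; $f^{-1}$ is the inverse function of $f$ (on the range of $f$). *)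

(* Defs.v *)
From HB Require Import structures.
From mathcomp Require Import all_boot all_order all_algebra.
From mathcomp Require Import lra.
From mathcomp Require Import all_classical all_reals all_analysis.

Set Implicit Arguments.
Unset Strict Implicit.
Unset Printing Implicit Defensive.

Import Order.TTheory GRing.Theory Num.Theory.
Import numFieldNormedType.Exports.

Local Open Scope classical_set_scope.
Local Open Scope ring_scope.

Record partial_metric (R : realType) (X : Type) (p : X -> X -> R) : Prop :=
  PartialMetric {
    pm_ge0 : forall x y, 0 <= p x y ;
    pm_sym : forall x y, p x y = p y x ;
    pm_eq : forall x y, p x x = p x y -> p x y = p y y -> x = y ;
    pm_small_self : forall x y, p x x <= p x y ;
    pm_triangle : forall x y z, p x z + p y y <= p x y + p y z
  }.

Definition pm_ball (R : realType) (X : Type) (p : X -> X -> R) (x : X) (e : R)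
  : set X := [set y | p x y < p x x + e].

Definition pm_dist (R : realType) (X : Type) (p : X -> X -> R) (x y : X) : R :=
  2 * p x y - p x x - p y y.

(* X with the topology tau_p whose base is the family of open p-balls. *)
Definition pm_topology (R : realType) (X : Type) (p : X -> X -> R)
  of partial_metric p : Type := X.

Section pm_topology.
Context (R : realType) (X : Type) (p : X -> X -> R) (pP : partial_metric p).

HB.instance Definition _ := gen_eqMixin (pm_topology pP).
HB.instance Definition _ := gen_choiceMixin (pm_topology pP).

Let D : set (set X) := [set B | exists x e, 0 < e /\ B = pm_ball p x e].

Let pm_ball_cover : \bigcup_(B in D) B = [set: X].
Proof.
apply/seteqP; split=> // x _; exists (pm_ball p x 1).
  by exists x, 1.
by rewrite /pm_ball /= ltrDl.
Qed.

Let pm_ball_join (A B : set X) (t : X) : D A -> D B -> A t -> B t ->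
  exists C, [/\ D C, C t & C `<=` A `&` B].
Proof.
move=> [x [e [e0 ->]]] [y [f [f0 ->]]]; rewrite /pm_ball /= => xt yt.
pose d := Num.min (p x x + e - p x t) (p y y + f - p y t).
have d0 : 0 < d by rewrite /d lt_min; apply/andP; split; lra.
exists (pm_ball p t d); split.
- by exists t, d.
- by rewrite /pm_ball /= ltrDl.
- move=> z; rewrite /pm_ball /= => tz.
  have dl : d <= p x x + e - p x t by rewrite /d ge_min lexx.
  have dr : d <= p y y + f - p y t by rewrite /d ge_min lexx orbT.
  have := pm_triangle pP x t z; have := pm_triangle pP y t z.
  by split=> /=; lra.
Qed.

HB.instance Definition _ := @isBaseTopological.Build (pm_topology pP)
  (set X) D id pm_ball_cover pm_ball_join.

End pm_topology.

(* X with the metric p^s. *)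
Definition pm_metric (R : realType) (X : Type) (p : X -> X -> R)
  of partial_metric p : Type := X.

Section pm_metric.
Context (R : realType) (X : Type) (p : X -> X -> R) (pP : partial_metric p).

HB.instance Definition _ := gen_eqMixin (pm_metric pP).
HB.instance Definition _ := gen_choiceMixin (pm_metric pP).

Let pm_dist_refl x : pm_dist p x x = 0.
Proof. by rewrite /pm_dist; lra. Qed.

Let pm_dist_sym x y : pm_dist p x y = pm_dist p y x.
Proof. by rewrite /pm_dist (pm_sym pP y x); lra. Qed.

Let pm_dist_triangle y x z :
  pm_dist p x z <= pm_dist p x y + pm_dist p y z.
Proof. by have := pm_triangle pP x y z; rewrite /pm_dist; lra. Qed.

Let pm_dist_eq x y : pm_dist p x y = 0 -> x = y.
Proof.
have := pm_small_self pP x y; have := pm_small_self pP y x.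
rewrite /pm_dist (pm_sym pP y x) => h1 h2 h3.
by apply: (pm_eq pP); lra.
Qed.

HB.instance Definition _ := @isMetric.Build R (pm_metric pP) (pm_dist p)
  pm_dist_refl pm_dist_eq pm_dist_sym pm_dist_triangle.

End pm_metric.

Definition pm_cauchy (R : realType) (X : Type) (p : X -> X -> R)
  (x_ : nat -> X) : Prop :=
  exists l : R, p (x_ nm.1) (x_ nm.2) @[nm --> (\oo, \oo)] --> l.

Definition pm_complete (R : realType) (X : Type) (p : X -> X -> R)
  (pP : partial_metric p) : Prop :=
  forall x_ : nat -> X, pm_cauchy p x_ ->
  exists x : X, (x_ : nat -> pm_topology pP) @ \oo --> (x : pm_topology pP) /\
    p (x_ nm.1) (x_ nm.2) @[nm --> (\oo, \oo)] --> p x x.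

Definition pm_inf (R : realType) (X : Type) (p : X -> X -> R) : R :=
  inf [set p x y | x in [set: X] & y in [set: X]].

Definition pm_min_set (R : realType) (X : Type) (p : X -> X -> R) : set X :=
  [set x | p x x = pm_inf p].

(* Main.v *)
Require Import Defs.
From mathcomp Require Import all_boot all_order all_algebra.
From mathcomp Require Import lra.
From mathcomp Require Import all_classical all_reals all_analysis.

(** Write [rho] for [pm_inf p] and [f t] for [t - phi t].  Call [x] almost
fixed when [p x (T x)] is close to [rho].  Since every value of [p] is at least
[rho], the self-distances of [x] and of [T x] are then close to [rho] as well.

Everything rests on one estimate: two almost fixed points are at distance
close to [rho] ([almost_fixed_near]).  Going from [x] to [y] through [T x] and
[T y], with [t = p x y], the triangle inequality gives
[t <= 2 d + p (T x) (T y)] for a small [d].  Either [f t <= 2 d], which forces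
[t] to be small because [f] is nondecreasing and positive away from [0], or [t]
is bounded by [2 d] plus a self-distance, hence is close to [rho].

So a sequence of points that are more and more almost fixed is Cauchy, and its
limit [u] has self-distance [rho]; by the triangle inequality again
[p u (T u) = rho], hence [T u = u] ([almost_fixed_cvg]).  Two such fixed points
coincide by the same estimate ([min_fixed_unique]).

Almost fixed points exist: along an orbit, [p (T^k x) (T^k.+1 x)] is at most the
maximum of [p x x] and of [phi^k (p x (T x))], and the latter tends to [0]
([orbit_step_le]).  Starting from points [x] with [p x x] close to [rho], this
gives a sequence whose limit lies in [X_p]; starting from [x] in [X_p] itself,
the orbit of [x] is such a sequence, and so it converges to the unique fixed
point.  Convergence for [p^s] follows since the self-distances also tend to
[rho]. *)

Import Order.TTheory GRing.Theory Num.Theory.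
Import numFieldNormedType.Exports.

Local Open Scope classical_set_scope.
Local Open Scope ring_scope.

(** * The infimum and convergence in a partial metric space *)

Section partial_metric_lemmas.
Set Implicit Arguments.
Unset Strict Implicit.
Context (R : realType) (X : Type) (p : X -> X -> R) (pP : partial_metric p).

Lemma pm_inf_le x y : pm_inf p <= p x y.
Proof.
apply: ge_inf; last by exists x => //; exists y.
by exists 0 => _ [a _ [b _ <-]]; exact: pm_ge0 pP a b.
Qed.

Lemma pm_inf_ge0 : [set: X] !=set0 -> 0 <= pm_inf p.
Proof.
move=> [x _]; apply: lb_le_inf.
  by exists (p x x); exists x => //; exists x.
by move=> _ [a _ [b _ <-]]; exact: pm_ge0 pP a b.
Qed.

(** Since [p x x <= p x y], the infimum is already approached on the
diagonal. *)
Lemma pm_inf_adherent (e : R) : [set: X] !=set0 -> 0 < e ->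
  exists x, p x x < pm_inf p + e.
Proof.
move=> [x _] e0; have [|_ [a _ [b _ <-]] ab] :=
  @inf_adherent R [set p x y | x in [set: X] & y in [set: X]] e e0.
  split; first by exists (p x x); exists x => //; exists x.
  by exists 0 => _ [a _ [b _ <-]]; exact: pm_ge0 pP a b.
by exists a; exact: le_lt_trans (pm_small_self pP a b) ab.
Qed.

(** The values of [p] are bounded below by [pm_inf p], so an eventual upper
bound is enough for convergence to it. *)
Lemma cvg_pm_inf {I : Type} (F : set_system I) {FF : Filter F} (g h : I -> X) :
  (forall e, 0 < e -> \forall i \near F, p (g i) (h i) <= pm_inf p + e) ->
  p (g i) (h i) @[i --> F] --> pm_inf p.
Proof.
move=> gh; apply/cvgrPdist_le => e e0.
apply: filterS (gh e e0) => i ghi.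
by rewrite distrC ger0_norm ?subr_ge0 ?pm_inf_le // lerBlDl.
Qed.

(** Both self-distances and the distance are then [pm_inf p], which is the case
of equality in the separation axiom. *)
Lemma pm_min_set_eq u v : pm_min_set p u -> pm_min_set p v ->
  (forall e, 0 < e -> p u v <= pm_inf p + e) -> u = v.
Proof.
rewrite /pm_min_set /= => uu vv uv.
have {}uv : p u v = pm_inf p.
  by apply/eqP; rewrite eq_le pm_inf_le andbT; apply/ler_addgt0Pr.
by apply: (pm_eq pP); rewrite ?uu ?vv uv.
Qed.

Lemma pm_topology_cvg_le (x_ : nat -> X) (x : X) (e : R) :
  (x_ : nat -> pm_topology pP) @ \oo --> (x : pm_topology pP) -> 0 < e ->
  \forall n \near \oo, p x (x_ n) <= p x x + e.
Proof.
move=> x_x e0.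
have : nbhs (x : pm_topology pP) (pm_ball p x e).
  apply: (@open_nbhs_nbhs (pm_topology pP)); split.
    exists [set pm_ball p x e]; last by rewrite bigcup_set1.
    by move=> _ ->; exists x, e.
  by rewrite /pm_ball /= ltrDl.
move=> /x_x xB; apply: (@filterS _ \oo _ (x_ @^-1` pm_ball p x e)) xB => n.
by rewrite /pm_ball /= => /ltW.
Qed.

Lemma pm_metric_cvg (x_ : nat -> X) (u : X) :
  p u (x_ n) @[n --> \oo] --> p u u ->
  p (x_ n) (x_ n) @[n --> \oo] --> p u u ->
  (x_ : nat -> pm_metric pP) @ \oo --> (u : pm_metric pP).
Proof.
move=> /cvgrPdist_lt ux /cvgrPdist_lt xx; apply/cvg_ballP => e e0.
have e4 : 0 < e / 4 by rewrite divr_gt0.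
apply: filterS2 (ux _ e4) (xx _ e4) => n; rewrite !ltr_distl.
move=> /andP[a1 a2] /andP[b1 b2].
by rewrite ballEmdist /= /mdist /= /pm_dist; lra.
Qed.

End partial_metric_lemmas.

(** * Almost fixed points of the contraction *)

Section contraction.
Set Implicit Arguments.
Unset Strict Implicit.
Context (R : realType) (X : Type) (p : X -> X -> R) (pP : partial_metric p).
Context (phi : R -> R).
Hypothesis phi_ge0 : forall t, 0 <= t -> 0 <= phi t.
Hypothesis phi_incr : forall s t, 0 <= s -> s <= t -> phi s <= phi t.
Hypothesis f_incr : forall s t, 0 <= s -> s <= t -> s - phi s <= t - phi t.
Hypothesis phi_iter :
  forall t, 0 <= t -> iter n phi t @[n --> \oo] --> (0 : R).
Context (T : X -> X).
Hypothesis T_contr : forall x y,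
  p (T x) (T y) <= Num.max (phi (p x y)) (Num.max (p x x) (p y y)).

(** If [t <= phi t], monotonicity keeps all the iterates at least [t], so they
cannot tend to [0]. *)
Lemma phi_lt t : 0 < t -> phi t < t.
Proof.
move=> t0; rewrite ltNge; apply/negP => t_le.
have iter_ge n : t <= iter n phi t.
  elim: n => [|n IHn] //=; apply: (le_trans t_le).
  exact: phi_incr (ltW t0) IHn.
have : t <= 0.
  rewrite -(cvg_lim _ (phi_iter (ltW t0))) //; apply: limr_ge.
    by apply/cvg_ex; exists 0; exact: phi_iter (ltW t0).
  exact: nearW.
by rewrite leNgt t0.
Qed.

Lemma phi_le t : 0 <= t -> phi t <= t.
Proof.
move=> t0; apply/ler_addgt0Pr => e e0.
have te0 : 0 < t + e by rewrite ltr_wpDl.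
apply: le_trans (ltW (phi_lt te0)).
by apply: phi_incr => //; rewrite lerDl ltW.
Qed.

(** The self-distances do not increase along an orbit, so the bound [p x x] in
the contraction condition may be kept at every step. *)
Lemma orbit_step_le x k :
  p (iter k T x) (iter k.+1 T x) <= Num.max (iter k phi (p x (T x))) (p x x).
Proof.
have pxx n : p (iter n T x) (iter n T x) <= p x x.
  elim: n => [|n IHn] //=; apply: le_trans (T_contr _ _) _.
  by rewrite !ge_max !IHn (le_trans (phi_le (pm_ge0 pP _ _))).
elim: k => [|k IHk] /=; first by rewrite le_max lexx.
apply: le_trans (T_contr _ _) _.
rewrite !ge_max !le_max (pxx k) (pxx k.+1) !orbT !andbT.
move: IHk; rewrite le_max => /orP[] IHk; apply/orP; [left|right].
  exact: phi_incr (pm_ge0 pP _ _) IHk.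
exact: le_trans (phi_le (pm_ge0 pP _ _)) IHk.
Qed.

Lemma orbit_almost_fixed x e : 0 < e ->
  \forall k \near \oo, p (iter k T x) (T (iter k T x)) <= p x x + e.
Proof.
move=> e0; have /cvgrPdist_le/(_ e e0) := phi_iter (pm_ge0 pP x (T x)).
apply: filterS => k; rewrite sub0r normrN => /ler_normlW phik.
apply: le_trans (orbit_step_le x k) _.
by have := pm_ge0 pP x x; rewrite ge_max; lra.
Qed.

Hypothesis X_neq0 : [set: X] !=set0.

(** Let [d] be the tolerance, a third of [f e], and suppose [e < p x y].  The
detour through [T x] and [T y] costs [2 d].  If [phi (p x y)] is the maximum in
the contraction condition, then [f (p x y) <= 2 d < f e], against the
monotonicity of [f].  Otherwise the maximum is a self-distance, at most
[pm_inf p + d], and the total excess is [3 d = f e <= e]. *)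
Lemma almost_fixed_near e x y : 0 < e ->
  p x (T x) <= pm_inf p + (e - phi e) / 3 ->
  p y (T y) <= pm_inf p + (e - phi e) / 3 ->
  p x y <= pm_inf p + e.
Proof.
move=> e0 xT yT; have rho0 := pm_inf_ge0 pP X_neq0.
have [t_le|t_gt] := leP (p x y) e; first by lra.
have fe := f_incr (ltW e0) (ltW t_gt).
have phie := phi_lt e0; have phie0 := phi_ge0 (ltW e0).
have xTy := pm_triangle pP x (T x) y.
have Txy := pm_triangle pP (T x) (T y) y.
rewrite (pm_sym pP (T y)) in Txy.
have TxTx := pm_inf_le pP (T x) (T x); have TyTy := pm_inf_le pP (T y) (T y).
have xx := pm_small_self pP x (T x); have yy := pm_small_self pP y (T y).
have := T_contr x y; rewrite !le_max => /orP[|/orP[]]; lra.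
Qed.

Lemma min_fixed_unique u v : pm_min_set p u -> pm_min_set p v ->
  T u = u -> T v = v -> u = v.
Proof.
move=> uM vM Tu Tv; apply: (pm_min_set_eq pP uM vM) => e e0.
move: uM vM; rewrite /pm_min_set /= => uM vM.
by apply: almost_fixed_near => //; rewrite ?Tu ?Tv ?uM ?vM lerDl;
  have := phi_lt e0; lra.
Qed.

(** The sequence is Cauchy with double limit [pm_inf p], so completeness
provides a limit [u] in [X_p].  That [T u] equals [u] follows by comparing both
to [x_ n] and [T (x_ n)] for [n] large. *)
Lemma almost_fixed_cvg (x_ : nat -> X) : pm_complete pP ->
  (forall e, 0 < e -> \forall n \near \oo,
    p (x_ n) (T (x_ n)) <= pm_inf p + e) ->
  exists u, [/\ pm_min_set p u, T u = u &
    (x_ : nat -> pm_metric pP) @ \oo --> (u : pm_metric pP)].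
Proof.
move=> p_complete xT.
have x_cauchy : p (x_ nm.1) (x_ nm.2) @[nm --> (\oo, \oo)] --> pm_inf p.
  apply: (cvg_pm_inf pP (g := fun nm => x_ nm.1) (h := fun nm => x_ nm.2)).
  move=> e e0.
  have d0 : 0 < (e - phi e) / 3 by have := phi_lt e0; lra.
  have near_d := xT _ d0.
  exists ([set n | p (x_ n) (T (x_ n)) <= pm_inf p + (e - phi e) / 3],
          [set n | p (x_ n) (T (x_ n)) <= pm_inf p + (e - phi e) / 3]) => //.
  by move=> [n m] /= [hn hm]; exact: almost_fixed_near.
have [u [x_u x_uu]] := p_complete x_ (ex_intro _ (pm_inf p) x_cauchy).
have uu : p u u = pm_inf p by exact: (cvg_unique _ x_uu x_cauchy).
have ux e : 0 < e -> \forall n \near \oo, p u (x_ n) <= pm_inf p + e.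
  by rewrite -uu; exact: pm_topology_cvg_le.
exists u; split=> //; last first.
  apply: pm_metric_cvg; rewrite uu; apply: cvg_pm_inf => // e e0.
  by apply: filterS (xT e e0) => n; exact: le_trans (pm_small_self pP _ _).
have uTu e : 0 < e -> p u (T u) <= pm_inf p + e.
  move=> e0; have d0 : 0 < e / 3 by lra.
  near \oo => n.
  have xTn : p (x_ n) (T (x_ n)) <= pm_inf p + e / 3.
    by near: n; exact: xT.
  have uxn : p u (x_ n) <= pm_inf p + e / 3 by near: n; exact: ux.
  have := pm_inf_le pP (x_ n) (x_ n).
  have := pm_inf_le pP (T (x_ n)) (T (x_ n)).
  have := pm_triangle pP u (x_ n) (T u).
  have := pm_triangle pP (x_ n) (T (x_ n)) (T u).
  have := pm_small_self pP (x_ n) (T (x_ n)).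
  have := phi_le (pm_ge0 pP (x_ n) u).
  rewrite (pm_sym pP (x_ n) u).
  have := T_contr (x_ n) u; rewrite (pm_sym pP (x_ n) u) uu.
  by rewrite !le_max => /orP[|/orP[]]; lra.
apply/esym/(pm_min_set_eq pP) => //.
rewrite /pm_min_set /=; apply/eqP; rewrite eq_le pm_inf_le // andbT.
apply/ler_addgt0Pr => e e0; apply: le_trans (uTu e e0).
by rewrite (pm_sym pP u); exact: pm_small_self.
Unshelve. all: by end_near.
Qed.

End contraction.

Theorem theorem2 (R : realType) (X : Type) (p : X -> X -> R)
  (pP : partial_metric p) (p_complete : pm_complete pP)
  (X_neq0 : [set: X] !=set0)
  (phi : R -> R)
  (phi_ge0 : forall t, 0 <= t -> 0 <= phi t)
  (phi_incr : forall s t, 0 <= s -> s <= t -> phi s <= phi t)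
  (f_incr : forall s t, 0 <= s -> s <= t -> s - phi s <= t - phi t)
  (finv : R -> R)
  (finvK : forall t, 0 <= t -> finv (t - phi t) = t)
  (finv_rcont : finv s @[s --> within [set t - phi t | t in [set t | 0 <= t]]
                                      (0 : R)^'+] --> finv 0)
  (phi_iter : forall t, 0 <= t -> iter n phi t @[n --> \oo] --> (0 : R))
  (T : X -> X)
  (T_contr : forall x y,
     p (T x) (T y) <= Num.max (phi (p x y)) (Num.max (p x x) (p y y))) :
  pm_min_set p !=set0 /\
  exists u : X,
    [/\ pm_min_set p u, T u = u,
        forall v, pm_min_set p v -> T v = v -> v = u &
        forall x, pm_min_set p x ->
          (iter n T x : pm_metric pP) @[n --> \oo] --> (u : pm_metric pP)].
Proof.
have cvg_fixed x_ := almost_fixed_cvg (x_ := x_) phi_ge0 phi_incr f_incr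
  phi_iter T_contr X_neq0 p_complete.
have unique := min_fixed_unique pP phi_ge0 phi_incr f_incr
  phi_iter T_contr X_neq0.
have almost := orbit_almost_fixed pP phi_incr phi_iter T_contr.
(* Half of the tolerance is for the self-distance of a starting point, half for
   the progress of its orbit. *)
have /choice[x_ x_fixed] (n : nat) :
    exists x, p x (T x) <= pm_inf p + n.+1%:R^-1.
  have : 0 < (n.+1%:R^-1 : R) by rewrite invr_gt0.
  move: (n.+1%:R^-1) => a a0; have e0 : 0 < a / 2 by lra.
  have [y yy] := pm_inf_adherent pP X_neq0 e0.
  near \oo => k; exists (iter k T y).
  apply: (@le_trans _ _ (p y y + a / 2)); last by lra.
  by near: k; exact: almost.
have [e e0|u [uM Tu _]] := cvg_fixed x_.
  near=> n; apply: le_trans (x_fixed n) _; rewrite lerD2l ltW //.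
  by near: n; exact: near_infty_natSinv_lt (PosNum e0).
split; first by exists u.
exists u; split=> // [v vM Tv|x xM]; first exact: unique.
have [e e0|v [vM Tv xv]] := cvg_fixed (fun n => iter n T x).
  by rewrite -[pm_inf p]xM; exact: almost.
by rewrite (unique u v).
Unshelve. all: by end_near.
Qed.
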